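(* Consider the sparse linear Gaussian model: $S\in\{1,\dots,N\}$, $\mathcal{X}_S=\{\mathbf{x}\in\mathbb{R}^N:\|\mathbf{x}\|_0\le S\}$, $\mathbf{H}\in\mathbb{R}^{M\times N}$ with $\operatorname{spark}(\mathbf{H})>S$, $\sigma>0$, observation $\mathbf{y}=\mathbf{H}\mathbf{x}+\mathbf{n}$, $\mathbf{n}\sim\mathcal{N}(\mathbf{0},\sigma^2\mathbf{I})$, parameter function $g(\mathbf{x})=x_k$ for fixed $k\in[N]$. Let $\mathbf{x}_0\in\mathcal{X}_S$ and let $\mathcal{K}=\{k_1,\dots,k_{|\mathcal{K}|}\}\subseteq[N]$ with $|\mathcal{K}|\le S$. Let $\mathbf{P}=\mathbf{H}_{\mathcal{K}}(\mathbf{H}_{\mathcal{K}})^{\dagger}$ and let $\widetilde{\mathbf{x}}_0\in\mathbb{R}^N$ be the unique vector with $\operatorname{supp}(\widetilde{\mathbf{x}}_0)\subseteq\mathcal{K}$ satisfying $\mathbf{H}\widetilde{\mathbf{x}}_0=\mathbf{P}\mathbf{H}\mathbf{x}_0$. Let $c:\mathcal{X}_S\to\mathbb{R}$ be a bias function such that the partial derivatives $\frac{\partial c(\mathbf{x})}{\partial x_{k_i}}\big|_{\mathbf{x}=\widetilde{\mathbf{x}}_0}$ exist for all $k_i\in\mathcal{K}$, let $\gamma(\mathbf{x})=c(\mathbf{x})+x_k$, and define $\mathbf{b}_{\mathbf{x}_0}\in\mathbb{R}^{|\mathcal{K}|}$ by $(\mathbf{b}_{\mathbf{x}_0})_i=\delta_{k,k_i}+\frac{\partial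 c(\mathbf{x})}{\partial x_{k_i}}\big|_{\mathbf{x}=\widetilde{\mathbf{x}}_0}$. Then $$M(c,\mathbf{x}_0)\ \ge\ \exp\Big(-\tfrac{1}{\sigma^2}\|(\mathbf{I}-\mathbf{P})\mathbf{H}\mathbf{x}_0\|_2^2\Big)\Big[\sigma^2\mathbf{b}_{\mathbf{x}_0}^T(\mathbf{H}_{\mathcal{K}}^T\mathbf{H}_{\mathcal{K}})^{-1}\mathbf{b}_{\mathbf{x}_0}+\gamma^2(\widetilde{\mathbf{x}}_0)\Big]-\gamma^2(\mathbf{x}_0).$$
   Context: $\mathbf{H}_{\mathcal{K}}$ is the submatrix of columns of $\mathbf{H}$ indexed by $\mathcal{K}$; $\dagger$ = pseudoinverse; $\delta$ is the Kronecker delta; $\operatorname{supp}$ = set of indices of nonzero entries. An estimator $\hat g:\mathbb{R}^M\to\mathbb{R}$ has bias $b(\hat g;\mathbf{x})=\mathsf{E}_{\mathbf{x}}\{\hat g(\mathbf{y})\}-x_k$ and variance $v(\hat g;\mathbf{x})$; $M(c,\mathbf{x}_0)$ is the infimum of $v(\hat g;\mathbf{x}_0)$ over all estimators with $v(\hat g;\mathbf{x}_0)<\infty$ and $b(\hat g;\mathbf{x})=c(\mathbf{x})$ for all $\mathbf{x}\in\mathcal{X}_S$ (and $+\infty$ if there is none). *)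

(* Defs.v *)
From HB Require Import structures.
From mathcomp Require Import all_boot all_order all_algebra.
From mathcomp Require Import all_classical all_reals all_analysis.
From mathcomp Require Import normal_distribution.

Set Implicit Arguments.
Unset Strict Implicit.
Unset Printing Implicit Defensive.

Import Order.TTheory GRing.Theory Num.Theory.
Import numFieldNormedType.Exports.

Local Open Scope classical_set_scope.
Local Open Scope ring_scope.

Definition l0norm {R : pzRingType} {N : nat} (x : 'cV[R]_N) : nat :=
  #|[set i : 'I_N | x i 0 != 0]|.

Definition supp {R : pzRingType} {N : nat} (x : 'cV[R]_N) : {set 'I_N} :=
  [set i : 'I_N | x i 0 != 0].

Definition sparse_set {R : pzRingType} (N S : nat) : set 'cV[R]_N :=
  [set x | (l0norm x <= S)%N].

(* H_K : the columns of H indexed by K, in increasing order k_1 < ... *)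
Definition colsK {R : Type} {M N : nat} (H : 'M[R]_(M, N)) (K : {set 'I_N})
  : 'M[R]_(M, #|K|) :=
  colsub (fun j : 'I_#|K| => enum_val j) H.

Definition cols_indep {F : fieldType} {M N : nat} (H : 'M[F]_(M, N))
  (T : {set 'I_N}) : bool :=
  \rank (colsK H T) == #|T|.

(* spark H = smallest number of linearly dependent columns of H;
   if all columns are independent, spark H = +infinity, encoded as N.+1 *)
Definition spark {F : fieldType} {M N : nat} (H : 'M[F]_(M, N)) : nat :=
  \big[minn/N.+1]_(T : {set 'I_N} | ~~ cols_indep H T) #|T|.

Definition is_pinv {R : pzRingType} {m n : nat} (A : 'M[R]_(m, n))
  (B : 'M[R]_(n, m)) : Prop :=
  [/\ A *m B *m A = A, B *m A *m B = B,
      (A *m B)^T = A *m B & (B *m A)^T = B *m A].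

(* The Moore-Penrose pseudoinverse A^dagger (exists and is unique) *)
Definition mp_pinv {R : realType} {m n : nat} (A : 'M[R]_(m, n)) : 'M[R]_(n, m) :=
  xget 0 [set B | is_pinv A B].

Definition sqnorm {R : pzRingType} {n : nat} (v : 'cV[R]_n) : R :=
  \sum_i v i 0 ^+ 2.

(* Observations y live in R^M, represented as M.-tuple R with the      *)
(* product (Borel) sigma-algebra.                                       *)

Local Open Scope ereal_scope.

(* Integral of a nonnegative function f : R^n -> [0,+oo] against the
   product Gaussian measure  N(m 0, s^2) x ... x N(m (n-1), s^2),
   computed as an iterated integral (Tonelli). *)
Fixpoint gauss_int {R : realType} (s : R) (n : nat) :
  (nat -> R) -> (n.-tuple R -> \bar R) -> \bar R :=
  match n return (nat -> R) -> (n.-tuple R -> \bar R) -> \bar R with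
  | 0 => fun _ f => f [tuple]
  | n'.+1 => fun m f =>
      \int[normal_prob (m 0%N) s]_(y in [set: R])
        gauss_int s (fun i => m i.+1) (fun t => f (cons_tuple y t))
  end.

Definition model_mean {R : realType} {M N : nat} (H : 'M[R]_(M, N))
  (x : 'cV[R]_N) : nat -> R :=
  fun i => match @insub nat (fun i => i < M)%N 'I_M i with
           | Some j => (H *m x) j ord0
           | None => 0%R
           end.

Definition mean_est {R : realType} {M N : nat} (H : 'M[R]_(M, N)) (sigma : R)
  (x : 'cV[R]_N) (g : M.-tuple R -> R) : \bar R :=
  gauss_int sigma (model_mean H x) (fun y => (Num.max (g y) 0%R)%:E)
  - gauss_int sigma (model_mean H x) (fun y => (Num.max (- g y) 0%R)%:E).

Definition var_est {R : realType} {M N : nat} (H : 'M[R]_(M, N)) (sigma : R)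
  (x : 'cV[R]_N) (g : M.-tuple R -> R) : \bar R :=
  gauss_int sigma (model_mean H x)
    (fun y => ((g y - fine (mean_est H sigma x g)) ^+ 2)%:E).

(* M(c, x0): infimum of v(g; x0) over all (measurable) estimators g with
   v(g; x0) < oo and bias b(g; x) = E_x{g(y)} - x_k = c(x) on X_S;
   +oo if there is no such estimator (ereal_inf set0 = +oo). *)
Definition min_var {R : realType} {M N : nat} (S : nat) (H : 'M[R]_(M, N))
  (sigma : R) (k : 'I_N) (c : 'cV[R]_N -> R) (x0 : 'cV[R]_N) : \bar R :=
  ereal_inf [set var_est H sigma x0 g | g in
    [set g : M.-tuple R -> R |
       [/\ measurable_fun [set: M.-tuple R] g,
           var_est H sigma x0 g < +oo &
           forall x, sparse_set S x ->
             mean_est H sigma x g = (c x + x k ord0)%:E]]].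

(* Main.v *)
Require Import Defs.
From HB Require Import structures.
From mathcomp Require Import all_boot all_order all_algebra.
From mathcomp Require Import all_classical all_reals all_analysis.
From mathcomp Require Import normal_distribution measurable_realfun.
From mathcomp Require Import ring lra.
Import Order.TTheory GRing.Theory Num.Theory.
Import numFieldNormedType.Exports.
Local Open Scope classical_set_scope.
Local Open Scope ring_scope.

Set Implicit Arguments.
Unset Strict Implicit.
Unset Printing Implicit Defensive.

(** Let p_x be the density of N(Hx, sigma^2 I) relative to N(Hx0, sigma^2 I).
    An admissible estimator g satisfies E_x0[g p_x] = gamma(x) for all S-sparse
    x, and E_x0[p_x p_x'] = exp(<H(x - x0), H(x' - x0)> / sigma^2), because
    p_x p_x' is a constant multiple of p_(x + x' - x0). Integrating
    (g - L)^2 >= 0 for a linear combination L of the p_x bounds the variance of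
    g from below in terms of gamma and this kernel alone. Take L to be
    alpha p_xt plus a combination of the difference quotients of p_x at xt in
    the directions of K. Since H(xt - x0) is orthogonal to the range of H_K, the
    kernel factors as exp(|(I - P) H x0|^2 / sigma^2) times a kernel centred at
    xt. Letting the step tend to 0 and choosing the optimal coefficients,
    proportional to gamma(xt) and sigma^2 (H_K^T H_K)^-1 b, gives the bound. *)

(** * Change of density for integrals of nonnegative functions *)

Section density.
Local Open Scope ereal_scope.
Import HBNNSimple.

(** Both sides agree on indicators by the hypothesis on [nu], hence on simple functions by
    linearity; monotone convergence along [nnsfun_approx] carries this over to [f]. *)
Lemma ge0_integral_density (d : measure_display) (T : measurableType d)
    (R : realType) (mu nu : {measure set T -> \bar R}) (p : T -> R)
    (f : T -> \bar R) :
  measurable_fun setT p -> (forall x, 0 <= p x)%R ->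
  (forall A, measurable A -> nu A = \int[mu]_(x in A) (p x)%:E) ->
  measurable_fun setT f -> (forall x, 0 <= f x) ->
  \int[nu]_x f x = \int[mu]_x (f x * (p x)%:E).
Proof.
move=> mp p0 nuE mf f0.
have mEp : measurable_fun setT (EFin \o p) by exact/measurable_EFinP.
pose f_ := nnsfun_approx measurableT mf.
transitivity (limn (fun n => \int[nu]_x (f_ n x)%:E)).
  rewrite -monotone_convergence//.
  - apply: eq_integral => y _; apply/esym/cvg_lim => //.
    exact: cvg_nnsfun_approx.
  - by move=> n; exact/measurable_EFinP/measurable_funP.
  - by move=> n y _; rewrite lee_fin.
  - by move=> y _ m n mn; rewrite lee_fin; exact/lefP/nd_nnsfun_approx.
rewrite [X in limn X](_ : _ =
    (fun n => \int[mu]_x ((f_ n x)%:E * (p x)%:E))).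
  rewrite -monotone_convergence//; last 3 first.
  - by move=> n; apply: emeasurable_funM => //; exact/measurable_EFinP.
  - by move=> n x _; rewrite -EFinM lee_fin mulr_ge0.
  - move=> x _ m n mn; rewrite -!EFinM lee_fin ler_wpM2r//.
    exact/lefP/nd_nnsfun_approx.
  apply: eq_integral => x _; apply/cvg_lim => //.
  apply: cvgeZr => //; exact: cvg_nnsfun_approx.
apply/funext => n.
transitivity (\sum_(k \in range (f_ n)) k%:E * nu (f_ n @^-1` [set k])).
  under eq_integral do rewrite fimfunE -fsumEFin//.
  rewrite ge0_integral_fsum//; last 2 first.
  - by move=> y; exact/measurable_EFinP/measurable_funM.
  - by move=> y x _; rewrite nnfun_muleindic_ge0.
  apply: eq_fsbigr => r _.
  by rewrite integralZl_indic_nnsfun// integral_indic// setIT.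
transitivity (\int[mu]_x (\sum_(k \in range (f_ n))
    (k * \1_(f_ n @^-1` [set k]) x)%:E * (p x)%:E)); last first.
  apply: eq_integral => x _; rewrite [in RHS]fimfunE -fsumEFin//.
  by rewrite ge0_mule_fsuml// => k; exact: nnfun_muleindic_ge0.
rewrite ge0_integral_fsum//; last 2 first.
- move=> y; apply: emeasurable_funM => //.
  exact/measurable_EFinP/measurable_funM.
- by move=> y x _; rewrite mule_ge0 ?nnfun_muleindic_ge0// lee_fin.
apply: eq_fsbigr => r; rewrite inE => -[t _ rt].
have r0 : (0 <= r)%R by rewrite -rt.
under [RHS]eq_integral do rewrite EFinM -muleA.
rewrite ge0_integralZl//; last 2 first.
- by apply: emeasurable_funM => //; exact/measurable_EFinP.
- by move=> x _; rewrite -EFinM lee_fin mulr_ge0.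
rewrite nuE//; congr (_ * _); rewrite [LHS]integral_mkcond.
apply: eq_integral => x _; rewrite patchE indicE.
by case: ifPn => _; rewrite ?mul1e ?mul0e.
Qed.

End density.

(** * Gaussian likelihood ratios and change of mean in [gauss_int] *)

(** The quotient at [y] of the densities of N(m, s^2) and N(m0, s^2), with the difference of squares
    in the exponent expanded around [m0]. *)
Definition gauss_ratio {R : realType} (s m0 m y : R) : R :=
  expR ((y - m0) * (m - m0) / s ^+ 2 - (m - m0) ^+ 2 / (s ^+ 2 *+ 2)).

Lemma measurable_gauss_ratio (R : realType) (s m0 m : R) :
  measurable_fun [set: R] (gauss_ratio s m0 m).
Proof.
apply: measurableT_comp => //; apply: measurable_funB => //.
apply: measurable_funM => //; apply: measurable_funM => //.
exact: measurable_funB.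
Qed.

Lemma normal_pdf_shift (R : realType) (s m0 m y : R) : s != 0 ->
  normal_pdf m s y = gauss_ratio s m0 m y * normal_pdf m0 s y.
Proof.
move=> s0; rewrite !normal_pdfE// /normal_fun mulrCA; congr (_ * _).
by rewrite -expRD; congr expR; field.
Qed.

Lemma integral_normal_prob_shift (R : realType) (s m0 m : R)
    (f : R -> \bar R) :
  s != 0 -> measurable_fun [set: R] f -> (forall y, 0 <= f y)%E ->
  (\int[normal_prob m s]_y f y =
   \int[normal_prob m0 s]_y (f y * (gauss_ratio s m0 m y)%:E))%E.
Proof.
move=> s0 mf f0.
have mr := @measurable_gauss_ratio R s m0 m.
have mfr : measurable_fun [set: R]
    (fun y => (f y * (gauss_ratio s m0 m y)%:E)%E).
  by apply: emeasurable_funM => //; exact/measurable_EFinP.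
rewrite (@ge0_integral_density _ _ R lebesgue_measure
  (normal_prob m s) (normal_pdf m s))//;
  last 2 first.
- exact: measurable_normal_pdf.
- by move=> y; exact: normal_pdf_ge0.
rewrite (@ge0_integral_density _ _ R lebesgue_measure
  (normal_prob m0 s) (normal_pdf m0 s))//;
  last 3 first.
- exact: measurable_normal_pdf.
- by move=> y; exact: normal_pdf_ge0.
- by move=> y; rewrite mule_ge0// lee_fin expR_ge0.
apply: eq_integral => y _.
by rewrite (@normal_pdf_shift R s m0 m y)// EFinM muleA.
Qed.

(* [normal_prob] lives on [measurableTypeR R], whose display differs from the
   default one carried by [R]. *)
Lemma measurable_cons_tuple (R : realType) (n : nat) :
  measurable_fun [set: measurableTypeR R * n.-tuple R]
    (fun z => cons_tuple z.1 z.2 : n.+1.-tuple R).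
Proof.
by apply: (@measurable_cons _ _ (measurableTypeR R * n.-tuple R)%type R fst n
  snd).
Qed.

(** Makes integration theory available for the iterated integral: the measure is the image under
    [cons_tuple] of the product of the first normal law with the measure of the remaining
    coordinates, and Tonelli unfolds it. *)
Lemma gauss_int_probability (R : realType) (s : R) (n : nat) (m : nat -> R) :
  exists P : probability (n.-tuple R) R,
    forall f : n.-tuple R -> \bar R,
      measurable_fun setT f -> (forall t, 0 <= f t)%E ->
      gauss_int s m f = (\int[P]_t f t)%E.
Proof.
elim: n m => [|n IH] m.
  (* In dimension 0 the integral is evaluation at the empty tuple. *)
  exists (@dirac _ (0.-tuple R) [tuple] R) => f mf f0 /=.
  by rewrite integral_dirac// diracT mul1e.
have [P PE] := IH (fun i => m i.+1).
pose X : {mfun (measurableTypeR R * n.-tuple R)%type >-> n.+1.-tuple R} :=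
  HB.pack (fun z : (measurableTypeR R * n.-tuple R)%type =>
      cons_tuple z.1 z.2 : n.+1.-tuple R)
    (isMeasurableFun.Build _ _ _ _ _ (@measurable_cons_tuple R n)).
exists (distribution (normal_prob (m 0%N) s \x P)%E X) => f mf f0 /=.
have mfX : measurable_fun [set: measurableTypeR R * n.-tuple R] (f \o X).
  exact: measurableT_comp.
rewrite ge0_integral_distribution//.
rewrite fubini_tonelli1//; last by move=> z; exact: f0.
apply: eq_integral => y _.
rewrite PE//.
exact: (measurableT_comp mfX (measurable_pair1 y)).
Qed.

Definition gauss_lr {R : realType} (s : R) (m0 m : nat -> R) {n : nat}
    (t : n.-tuple R) : R :=
  \prod_(i < n) gauss_ratio s (m0 i) (m i) (tnth t i).

Lemma gauss_lr_gt0 (R : realType) (s : R) (m0 m : nat -> R) (n : nat)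
    (t : n.-tuple R) :
  0 < gauss_lr s m0 m t.
Proof. by apply: prodr_gt0 => i _; exact: expR_gt0. Qed.

Lemma gauss_lr_cons (R : realType) (s : R) (m0 m : nat -> R) (n : nat) (y : R)
    (t : n.-tuple R) :
  gauss_lr s m0 m (cons_tuple y t) =
  gauss_ratio s (m0 0%N) (m 0%N) y *
  gauss_lr s (fun i => m0 i.+1) (fun i => m i.+1) t.
Proof.
rewrite /gauss_lr big_ord_recl; congr (_ * _).
by apply: eq_bigr => i _; rewrite tnthS.
Qed.

Lemma measurable_gauss_lr (R : realType) (s : R) (m0 m : nat -> R) (n : nat) :
  measurable_fun [set: n.-tuple R] (fun t => gauss_lr s m0 m t).
Proof.
apply: measurable_prod => i _.
apply: (measurableT_comp (@measurable_gauss_ratio R s (m0 i) (m i))).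
exact: measurable_tnth.
Qed.

Lemma gauss_lr_id (R : realType) (s : R) (m0 : nat -> R) (n : nat)
    (t : n.-tuple R) :
  gauss_lr s m0 m0 t = 1.
Proof.
by rewrite /gauss_lr big1// => i _; rewrite /gauss_ratio subrr mulr0 mul0r
  expr0n/= mul0r subrr expR0.
Qed.

(** The exponents are linear in y and quadratic in the mean shift; adding the two shifts leaves only
    the cross term, which does not depend on [t]. *)
Lemma gauss_lrM (R : realType) (s : R) (m0 m m' : nat -> R) (n : nat)
    (t : n.-tuple R) : s != 0 ->
  gauss_lr s m0 m t * gauss_lr s m0 m' t =
  expR (\sum_(i < n) (m i - m0 i) * (m' i - m0 i) / s ^+ 2) *
  gauss_lr s m0 (fun i => m i + m' i - m0 i) t.
Proof.
move=> s0; rewrite expR_sum -!big_split /=; apply: eq_bigr => i _.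
by rewrite /gauss_ratio -!expRD; congr expR; field.
Qed.

Lemma measurable_cons_tupler (R : realType) (n : nat) (y : R) :
  measurable_fun [set: n.-tuple R] (fun t => cons_tuple y t : n.+1.-tuple R).
Proof. exact: (@measurable_cons _ _ (n.-tuple R) R (cst y) n id). Qed.

(** The one-dimensional change of mean is applied to the outer coordinate and the induction
    hypothesis to the others; the two factors recombine by [gauss_lr_cons]. *)
Lemma gauss_int_shift (R : realType) (s : R) (m0 m : nat -> R) (n : nat)
    (f : n.-tuple R -> \bar R) :
  s != 0 -> measurable_fun setT f -> (forall t, 0 <= f t)%E ->
  gauss_int s m f = gauss_int s m0 (fun t => f t * (gauss_lr s m0 m t)%:E)%E.
Proof.
move=> s0; elim: n m0 m f => [|n IH] m0 m f mf f0 /=.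
  by rewrite /gauss_lr big_ord0 mule1.
have mfy y : measurable_fun [set: n.-tuple R] (fun t => f (cons_tuple y t)).
  by apply: (measurableT_comp mf); exact: measurable_cons_tupler.
pose m0' i := m0 i.+1; pose m' i := m i.+1.
have [P PE] := @gauss_int_probability R s n m0'.
have [P' P'E] := @gauss_int_probability R s n m'.
rewrite (@integral_normal_prob_shift _ _ (m0 0%N))//; last 2 first.
(* Measurability of the inner integral in [y] comes from Tonelli, once it is written as an integral
   against [P']. *)
- rewrite (_ : (fun _ => _) = (fun y => \int[P']_t f (cons_tuple y t))%E).
    apply: (@measurable_fun_fubini_tonelli_F _ _ (measurableTypeR R)
      (n.-tuple R) R P' (fun z => f (cons_tuple z.1 z.2))) => //.
    by apply: (measurableT_comp mf); exact: measurable_cons_tuple.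
  by apply/funext => y; rewrite P'E.
- by move=> y; rewrite P'E//; exact: integral_ge0.
apply: eq_integral => y _.
have mlr : measurable_fun [set: n.-tuple R]
    (fun t => (f (cons_tuple y t) * (gauss_lr s m0' m' t)%:E)%E).
  apply: emeasurable_funM => //; apply/measurable_EFinP.
  exact: measurable_gauss_lr.
have lr0 t : (0 <= f (cons_tuple y t) * (gauss_lr s m0' m' t)%:E)%E.
  by rewrite mule_ge0// lee_fin ltW// gauss_lr_gt0.
rewrite (IH m0' m')// PE// muleC -ge0_integralZl//; last first.
  by rewrite lee_fin expR_ge0.
rewrite -PE//; last 2 first.
- by apply: emeasurable_funM.
- by move=> t; rewrite mule_ge0// lee_fin expR_ge0.
congr gauss_int; apply/funext => t.
by rewrite gauss_lr_cons EFinM muleCA.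
Qed.

(** * Calculus of finite expectations and the variance inequality *)

Section integral_is.
Context (d : measure_display) (T : measurableType d) (R : realType).
Variable P : probability T R.
Implicit Types (f g : T -> R) (v w : R).

(** Integrability and value are kept together so that linear combinations carry no side
    conditions. *)
Definition integral_is f v : Prop :=
  P.-integrable setT (EFin \o f) /\ (\int[P]_x (f x)%:E)%E = v%:E.

Lemma eq_integral_is f g v : f =1 g -> integral_is f v -> integral_is g v.
Proof. by move=> /funext ->. Qed.

Lemma integral_is_cst v : integral_is (cst v) v.
Proof.
split; first exact: finite_measure_integrable_cst.
by rewrite -[LHS]/(\int[P]_x (cst v%:E) x)%E integral_cst//=
  probability_setT mule1.
Qed.

Lemma integral_isD f g v w : integral_is f v -> integral_is g w ->
  integral_is (fun x => f x + g x) (v + w).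
Proof.
move=> [fi fv] [gi gw]; split.
  rewrite (_ : _ \o _ = (EFin \o f) \+ (EFin \o g)); last exact/funext.
  exact: integrableD.
under eq_integral do rewrite EFinD.
by rewrite integralD// fv gw.
Qed.

Lemma integral_isZ c f v : integral_is f v ->
  integral_is (fun x => c * f x) (c * v).
Proof.
move=> [fi fv]; split.
  rewrite (_ : _ \o _ = (fun x => c%:E * (EFin \o f) x)%E); last exact/funext.
  exact: integrableZl.
under eq_integral do rewrite EFinM.
by rewrite integralZl// fv.
Qed.

Lemma integral_is_sum (I : Type) (r : seq I) (f : I -> T -> R) (v : I -> R) :
  (forall i, integral_is (f i) (v i)) ->
  integral_is (fun x => \sum_(i <- r) f i x) (\sum_(i <- r) v i).
Proof.
move=> fv; elim: r => [|i r IH].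
  rewrite big_nil; apply: eq_integral_is (integral_is_cst 0) => x.
  by rewrite big_nil.
rewrite big_cons; apply: eq_integral_is (integral_isD (fv i) IH) => x.
by rewrite big_cons.
Qed.

Lemma integral_is_ge0 f v : measurable_fun setT f -> (forall x, 0 <= f x) ->
  (\int[P]_x (f x)%:E)%E = v%:E -> integral_is f v.
Proof.
move=> mf f0 fv; split => //; apply/integrableP; split.
  exact/measurable_EFinP.
under eq_integral do rewrite /= ger0_norm//.
by rewrite fv ltry.
Qed.

Lemma le_integral_is f g v w : (forall x, f x <= g x) ->
  integral_is f v -> integral_is g w -> v <= w.
Proof.
move=> fg [fi fv] [gi gw]; rewrite -lee_fin -fv -gw.
by apply: le_integral => // x _; rewrite lee_fin.
Qed.

(* With l := \sum_i a i * L i, this integrates (g - l)^2 >= 0. *)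
Lemma variance_ge (n : nat) (g : T -> R) (L : 'I_n -> T -> R) (a c : 'I_n -> R)
    (G : 'I_n -> 'I_n -> R) (c0 v : R) :
  integral_is g c0 ->
  (forall i, integral_is (fun x => g x * L i x) (c i)) ->
  (forall i j, integral_is (fun x => L i x * L j x) (G i j)) ->
  integral_is (fun x => (g x - c0) ^+ 2) v ->
  2 * (\sum_i a i * c i) - \sum_i \sum_j a i * a j * G i j - c0 ^+ 2 <= v.
Proof.
move=> gc gL LL gv.
pose q i j x := a i * a j * (L i x * L j x).
have S1 : integral_is (fun x => \sum_i a i * (g x * L i x)) (\sum_i a i * c i).
  by apply: integral_is_sum => i; exact: integral_isZ.
have S2 : integral_is (fun x => \sum_i \sum_j q i j x)
    (\sum_i \sum_j a i * a j * G i j).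
  by do 2![apply: integral_is_sum => ?]; exact: integral_isZ.
have := integral_isD (integral_isD (integral_isD (integral_isZ 2 S1)
  (integral_isZ (-1) S2)) (integral_isZ (- (2 * c0)) gc))
  (integral_is_cst (c0 ^+ 2)).
move=> /le_integral_is - /(_ _ _ _ gv) le.
have /le : forall x, 2 * (\sum_i a i * (g x * L i x)) +
    -1 * (\sum_i \sum_j q i j x) + - (2 * c0) * g x + cst (c0 ^+ 2) x <=
    (g x - c0) ^+ 2.
  move=> x; pose l := \sum_i a i * L i x.
  have -> : \sum_i a i * (g x * L i x) = g x * l.
    by rewrite mulr_sumr; apply: eq_bigr => i _; rewrite mulrCA.
  have -> : \sum_i \sum_j q i j x = l ^+ 2.
    rewrite expr2 mulr_suml; apply: eq_bigr => i _.
    by rewrite mulr_sumr; apply: eq_bigr => j _; rewrite /q mulrACA.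
  by rewrite /= -subr_ge0; have := sqr_ge0 (g x - l); nra.
(* After integration, [- (2 * c0) * g] and [c0 ^+ 2] together contribute [- c0 ^+ 2]. *)
by apply: le_trans; nra.
Qed.

End integral_is.

(** * First and second moments of the likelihood ratios *)

Section gauss_moments.
Context (R : realType) (s : R) (n : nat) (m0 : nat -> R).
Hypothesis s_neq0 : s != 0.
Variable P : probability (n.-tuple R) R.
Hypothesis PE : forall f : n.-tuple R -> \bar R,
  measurable_fun setT f -> (forall t, 0 <= f t)%E ->
  gauss_int s m0 f = (\int[P]_t f t)%E.

Lemma gauss_int_lr (m : nat -> R) (f : n.-tuple R -> R) :
  measurable_fun setT f -> (forall t, 0 <= f t) ->
  gauss_int s m (fun t => (f t)%:E) =
  (\int[P]_t (f t * gauss_lr s m0 m t)%:E)%E.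
Proof.
move=> mf f0; rewrite (@gauss_int_shift _ _ m0)//; last exact/measurable_EFinP.
rewrite PE//.
- apply/measurable_EFinP/measurable_funM => //; exact: measurable_gauss_lr.
- by move=> t; rewrite lee_fin mulr_ge0// ltW// gauss_lr_gt0.
Qed.

(** The value is the total mass of the Gaussian with mean [m], by the change of mean applied to the
    constant 1. *)
Lemma integral_is_lr (m : nat -> R) : integral_is P (gauss_lr s m0 m) 1.
Proof.
apply: integral_is_ge0.
- exact: measurable_gauss_lr.
- by move=> t; rewrite ltW// gauss_lr_gt0.
have := @gauss_int_lr m (cst 1) (measurable_cst _) (fun=> ler01).
under [in X in _ = X -> _]eq_integral do rewrite mul1r.
move=> <-; have [Q QE] := @gauss_int_probability R s n m.
rewrite QE//; last exact/measurable_EFinP.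
by have [_ ->] := integral_is_cst Q 1.
Qed.

Lemma integral_is_lrM (m m' : nat -> R) :
  integral_is P (fun t => gauss_lr s m0 m t * gauss_lr s m0 m' t)
    (expR (\sum_(i < n) (m i - m0 i) * (m' i - m0 i) / s ^+ 2)).
Proof.
rewrite -[X in integral_is _ _ X]mulr1.
apply: eq_integral_is (integral_isZ _ (integral_is_lr _)) => t.
by rewrite gauss_lrM.
Qed.

Lemma integral_is_mean (m : nat -> R) (g : n.-tuple R -> R) (r : R) :
  measurable_fun setT g ->
  (gauss_int s m (fun y => (Num.max (g y) 0)%:E)
   - gauss_int s m (fun y => (Num.max (- g y) 0)%:E))%E = r%:E ->
  integral_is P (fun y => g y * gauss_lr s m0 m y) r.
Proof.
move=> mg.
have mgp : measurable_fun setT (fun y => Num.max (g y) 0).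
  exact: measurable_maxr.
have mgn : measurable_fun setT (fun y => Num.max (- g y) 0).
  by apply: measurable_maxr => //; exact: measurableT_comp.
have max0 x : 0 <= Num.max x 0 :> R by rewrite le_max lexx orbT.
have lr0 y : 0 <= gauss_lr s m0 m y by rewrite ltW// gauss_lr_gt0.
have mlr := @measurable_gauss_lr R s m0 m n.
have ge0 (f : n.-tuple R -> R) : (forall t, 0 <= f t) ->
    (0 <= \int[P]_t (f t * gauss_lr s m0 m t)%:E)%E.
  by move=> f0; apply: integral_ge0 => t _; rewrite lee_fin mulr_ge0.
rewrite !gauss_int_lr//.
have := ge0 _ (fun y => max0 (g y)); have := ge0 _ (fun y => max0 (- g y)).
set A := (\int[P]_t (Num.max (g t) 0 * _)%:E)%E.
set B := (\int[P]_t _)%E.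
(* Both parts are nonnegative and their difference is the real [r], so neither is infinite. *)
case AE : A => [u| |] //; case BE : B => [v| |] // _ _ [<-].
have pos : integral_is P (fun y => Num.max (g y) 0 * gauss_lr s m0 m y) u.
  apply: integral_is_ge0 => //; first exact: measurable_funM.
  by move=> t; rewrite mulr_ge0.
have neg : integral_is P (fun y => Num.max (- g y) 0 * gauss_lr s m0 m y) v.
  apply: integral_is_ge0 => //; first exact: measurable_funM.
  by move=> t; rewrite mulr_ge0.
rewrite -[- v]mulN1r.
apply: eq_integral_is (integral_isD pos (integral_isZ (-1) neg)) => y /=.
rewrite mulN1r -mulrBl; congr (_ * _).
by case: (leP (g y) 0) => gy; case: (leP (- g y) 0) => gy'; lra.
Qed.

End gauss_moments.

(** * Gram matrices, the pseudoinverse, spark and sparsity *)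

Lemma sqnorm_eq0 (R : realDomainType) (n : nat) (v : 'cV[R]_n) :
  sqnorm v = 0 -> v = 0.
Proof.
move=> /eqP; rewrite psumr_eq0; last by move=> i _; exact: sqr_ge0.
move=> /allP v0; apply/colP => i; rewrite mxE.
by have := v0 i (mem_index_enum i); rewrite /= sqrf_eq0 => /eqP.
Qed.

Lemma sqnormE (R : pzRingType) (n : nat) (v : 'cV[R]_n) :
  sqnorm v = (v^T *m v) 0 0.
Proof. by rewrite mxE; apply: eq_bigr => i _; rewrite mxE expr2. Qed.

(** A row v in the kernel of the Gram matrix satisfies |A v^T|^2 = v A^T A v^T = 0, so A v^T = 0,
    and full column rank forces v = 0. *)
Lemma gram_unitmx (R : realFieldType) (m n : nat) (A : 'M[R]_(m, n)) :
  \rank A = n -> A^T *m A \in unitmx.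
Proof.
move=> rA; rewrite -row_free_unit -kermx_eq0; apply/eqP/row_matrixP => i.
rewrite row0; set v := row i _.
have vG : v *m (A^T *m A) = 0 by apply/sub_kermxP; exact: row_sub.
have /(congr1 trmx) : A *m v^T = 0.
  apply: sqnorm_eq0; rewrite sqnormE trmx_mul trmxK mulmxA -(mulmxA v) vG.
  by rewrite mul0mx mxE.
rewrite trmx_mul trmxK trmx0 -[in RHS](mul0mx _ A^T).
by apply: row_free_inj; rewrite /row_free mxrank_tr rA.
Qed.

(** The explicit (A^T A)^-1 A^T meets the four Penrose conditions, so [xget] returns a matrix
    meeting them rather than its default 0. *)
Lemma mp_pinvP (R : realType) (m n : nat) (A : 'M[R]_(m, n)) :
  \rank A = n -> is_pinv A (mp_pinv A).
Proof.
move=> /gram_unitmx uA.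
suff pA : is_pinv A (invmx (A^T *m A) *m A^T) by
  exact: (@xgetI _ 0 [set B | is_pinv A B] _ pA).
split.
- by rewrite -!mulmxA mulVmx// mulmx1.
- by rewrite -[_ *m A^T *m A]mulmxA mulVmx// mul1mx.
- by rewrite !trmx_mul trmxK trmx_inv trmx_mul trmxK mulmxA.
- by rewrite -mulmxA mulVmx// trmx1.
Qed.

Lemma spark_cols_indep (F : fieldType) (M N : nat) (H : 'M[F]_(M, N))
    (K : {set 'I_N}) :
  (#|K| < spark H)%N -> cols_indep H K.
Proof.
apply: contraLR => nK; rewrite -leqNgt /spark -minEnat.
exact: (@bigmin_le_cond _ nat _ _ K (fun T => ~~ cols_indep H T)).
Qed.

Lemma sparse_set_supp (R : pzRingType) (N S : nat) (K : {set 'I_N})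
    (x : 'cV[R]_N) :
  (#|K| <= S)%N -> supp x \subset K -> sparse_set S x.
Proof.
move=> KS xK; apply: leq_trans KS; apply: subset_leq_card.
apply/fintype.subsetP => i; rewrite inE /= => xi.
by apply: (fintype.subsetP xK); rewrite inE.
Qed.

Lemma col_colsK (R : pzRingType) (M N : nat) (H : 'M[R]_(M, N))
    (K : {set 'I_N}) (i : 'I_#|K|) :
  H *m delta_mx (enum_val i) (0 : 'I_1) = col i (colsK H K).
Proof. by rewrite -colE; apply/colP => j; rewrite !mxE. Qed.

(** * The kernel bound at finitely many sparse points *)

Lemma model_meanE (R : realType) (M N : nat) (H : 'M[R]_(M, N))
    (x : 'cV[R]_N) (i : 'I_M) :
  model_mean H x i = (H *m x) i 0.
Proof. by rewrite /model_mean valK. Qed.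

(** The bias condition at [X i] fixes the expectation of g times the likelihood ratio of [X i]. The
    bound given by [variance_ge] is then the same for every admissible g, and passes to the
    infimum. *)
Lemma min_var_ge_kernel (R : realType) (M N S : nat) (H : 'M[R]_(M, N))
    (sigma : R) (k : 'I_N) (c : 'cV[R]_N -> R) (x0 : 'cV[R]_N)
    (n : nat) (X : 'I_n -> 'cV[R]_N) (a : 'I_n -> R) :
  sigma != 0 -> sparse_set S x0 -> (forall i, sparse_set S (X i)) ->
  ((2 * (\sum_i a i * (c (X i) + X i k 0))
    - \sum_i \sum_j a i * a j *
        expR (((H *m (X i - x0))^T *m (H *m (X j - x0))) 0 0 / sigma ^+ 2)
    - (c x0 + x0 k 0) ^+ 2)%:E <= min_var S H sigma k c x0)%E.
Proof.
move=> s0 sx0 sX; apply: le_ereal_inf_tmp => _ [g [mg vg cg] <-].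
have [P PE] := gauss_int_probability sigma M (model_mean H x0).
have mg2 : measurable_fun setT
    (fun y => (g y - fine (mean_est H sigma x0 g)) ^+ 2).
  by apply: measurable_funX; exact: measurable_funB.
have var_ge0 : (0 <= var_est H sigma x0 g)%E.
  rewrite /var_est PE; last by move=> t; rewrite lee_fin sqr_ge0.
    by apply: integral_ge0 => t _; rewrite lee_fin sqr_ge0.
  exact/measurable_EFinP.
have [v vE] : exists v, var_est H sigma x0 g = v%:E.
  by move: vg var_ge0; case: (var_est H sigma x0 g) => // v _ _; exists v.
rewrite vE lee_fin.
have gm x : sparse_set S x -> integral_is P
    (fun y => g y * gauss_lr sigma (model_mean H x0) (model_mean H x) y)
    (c x + x k 0).
  move=> sx; apply: (integral_is_mean s0 PE mg); exact: cg.
apply: (@variance_ge _ _ _ P n g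
  (fun i => gauss_lr sigma (model_mean H x0) (model_mean H (X i)))
  a (fun i => c (X i) + X i k 0)).
(* The likelihood ratio at [x0] itself is 1, so the condition there gives the plain mean of g. *)
- apply: eq_integral_is (gm _ sx0) => t.
  by rewrite gauss_lr_id mulr1.
- by move=> i; exact: gm.
- move=> i j; rewrite (_ : (_ *m _) 0 0 / _ = \sum_(l < M)
      (model_mean H (X i) l - model_mean H x0 l) *
      (model_mean H (X j) l - model_mean H x0 l) / sigma ^+ 2).
    exact: (integral_is_lrM s0 PE).
  rewrite mxE mulr_suml; apply: eq_bigr => l _.
  by rewrite !model_meanE !mulmxBr !mxE.
- apply: integral_is_ge0 => //.
  + by apply: measurable_funX; exact: measurable_funB.
  + by move=> t; exact: sqr_ge0.
  + rewrite -vE /var_est PE ?cg//.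
      by apply/measurable_EFinP; apply: measurable_funX; exact: measurable_funB.
    by move=> t; rewrite lee_fin sqr_ge0.
Qed.

(** * Difference quotients and their limit *)

Lemma cvg_expR_quotient (R : realType) (w : R) :
  (expR (t ^+ 2 * w) - 1) / t ^+ 2 @[t --> (0 : R)^'] --> w.
Proof.
apply: (@squeeze_cvgr _ _ _ _ (cst w) (fun t => w * expR (t ^+ 2 * w))).
- near=> t; have t2 : 0 < t ^+ 2.
    by rewrite exprn_even_gt0//=; near: t; exact: nbhs_dnbhs_neq.
  rewrite /= ler_pdivlMr// ler_pdivrMr//; set x := t ^+ 2 * w.
  have -> : w * t ^+ 2 = x by rewrite mulrC.
  have -> : w * expR x * t ^+ 2 = x * expR x by rewrite mulrAC (mulrC w).
  (* The squeeze is x <= e^x - 1 <= x e^x; the upper bound is e^(-x) >= 1 - x multiplied by e^x. *)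
  have := expR_ge1Dx x; have := expR_ge1Dx (- x).
  move=> /(ler_wpM2l (expR_ge0 x)); rewrite expRxMexpNx_1 => e1 e2.
  by apply/andP; split; lra.
- exact: cvg_cst.
- rewrite -[X in _ --> X]mulr1; apply: cvgMr.
  rewrite -expR0; apply: continuous_cvg; first exact: continuous_expR.
  rewrite -[X in _ --> X](mul0r w); apply: cvgMl.
  apply: cvg_within_filter.
  by have := @exprn_continuous R 2 0; rewrite /continuous_at expr0n/=.
Unshelve. all: by end_near. Qed.

Section difference_quotients.
Context (R : realType) (M N S : nat) (H : 'M[R]_(M, N)) (sigma : R) (k : 'I_N).
Context (c : 'cV[R]_N -> R) (x0 xt : 'cV[R]_N) (n : nat) (e : 'I_n -> 'cV[R]_N).
Hypothesis sigma_neq0 : sigma != 0.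
Hypothesis sparse_x0 : sparse_set S x0.
Hypothesis sparse_xt : sparse_set S xt.
Hypothesis sparse_e : forall i t, sparse_set S (t *: e i + xt).

Let u := H *m (xt - x0).
Hypothesis ortho : forall i, (H *m e i)^T *m u = 0.

Let gamma (x : 'cV[R]_N) := c x + x k 0.
Let G i j := ((H *m e i)^T *m (H *m e j)) 0 0.

Let He i t : H *m (t *: e i + xt - x0) = t *: (H *m e i) + u.
Proof. by rewrite -addrA mulmxDr -scalemxAr. Qed.

Let orthoT i : u^T *m (H *m e i) = 0.
Proof. by apply: trmx_inj; rewrite trmx_mul trmxK ortho trmx0. Qed.

Lemma min_var_ge_quotient (al : R) (a : 'I_n -> R) (t : R) : t != 0 ->
  ((2 * (al * gamma xt +
         \sum_i a i * (t^-1 * (gamma (t *: e i + xt) - gamma xt)))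
    - expR (sqnorm u / sigma ^+ 2) *
      (al ^+ 2 + \sum_i \sum_j a i * a j *
         ((expR (t ^+ 2 * (G i j / sigma ^+ 2)) - 1) / t ^+ 2))
    - gamma x0 ^+ 2)%:E <= min_var S H sigma k c x0)%E.
Proof.
move=> t0.
(* The n+1 points are [xt] and its shifts. Weight [a i / t] on a shift and [al - sa] on [xt] give
   [al] times the ratio at [xt] plus the [a i] times the difference quotients. *)
pose sa := \sum_i a i / t.
pose X (i : 'I_n.+1) := if unlift ord0 i is Some j then t *: e j + xt else xt.
pose b (i : 'I_n.+1) := if unlift ord0 i is Some j then a j / t else al - sa.
have X0 : X ord0 = xt by rewrite /X unlift_none.
have XS i : X (lift ord0 i) = t *: e i + xt by rewrite /X liftK.
have b0 : b ord0 = al - sa by rewrite /b unlift_none.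
have bS i : b (lift ord0 i) = a i / t by rewrite /b liftK.
have sX i : sparse_set S (X i) by rewrite /X; case: unlift.
pose E := expR (sqnorm u / sigma ^+ 2).
pose Q i j := expR (t ^+ 2 * (G i j / sigma ^+ 2)).
(* By [ortho] the cross terms with [u] vanish, so every kernel entry contains the factor [E]; only
   pairs of shifted points have a further factor. *)
have K00 : expR (((H *m (xt - x0))^T *m (H *m (xt - x0))) 0 0 / sigma ^+ 2) = E.
  by rewrite -sqnormE.
have K0S i : expR (((H *m (xt - x0))^T *m (H *m (t *: e i + xt - x0))) 0 0
    / sigma ^+ 2) = E.
  by rewrite He mulmxDr -scalemxAr orthoT scaler0 add0r -sqnormE.
have KS0 i : expR (((H *m (t *: e i + xt - x0))^T *m (H *m (xt - x0))) 0 0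
    / sigma ^+ 2) = E.
  rewrite He [(_ + _)^T]linearD /= [(t *: _)^T]linearZ /= mulmxDl -scalemxAl.
  by rewrite ortho scaler0 add0r -sqnormE.
have KSS i j : expR (((H *m (t *: e i + xt - x0))^T *m
    (H *m (t *: e j + xt - x0))) 0 0 / sigma ^+ 2) = E * Q i j.
  rewrite !He [(_ + _)^T]linearD /= [(t *: _)^T]linearZ /= mulmxDl.
  rewrite !mulmxDr -!scalemxAl -!scalemxAr ortho orthoT !scaler0 addr0 add0r.
  have scE (A : 'M[R]_1) : (t *: A) 0 0 = t * A 0 0 by rewrite mxE.
  rewrite -expRD mxE -sqnormE !scE -/(G i j); congr expR; ring.
have := min_var_ge_kernel H k c b sigma_neq0 sparse_x0 sX.
congr (_%:E <= _)%E; congr (_ - _); congr (2 * _ - _).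
  rewrite big_ord_recl b0 X0 mulrBl -addrA; congr (_ + _).
  rewrite /sa mulr_suml -sumrN -big_split /=; apply: eq_bigr => i _.
  by rewrite bS XS /gamma; ring.
rewrite big_ord_recl big_ord_recl b0 X0 K00.
under eq_bigr do rewrite bS XS K0S.
under [X in _ + X = _]eq_bigr do rewrite big_ord_recl b0 bS X0 XS KS0.
under [X in _ + X = _]eq_bigr do
  (under eq_bigr do rewrite bS XS KSS).
rewrite -/E.
have saE : \sum_i \sum_j a i * a j / t ^+ 2 = sa ^+ 2.
  rewrite [sa ^+ 2]expr2 /sa mulr_suml; apply: eq_bigr => i _.
  rewrite mulr_sumr; apply: eq_bigr => j _.
  by field.
(* The entries involving [xt] sum to E ((al - sa)^2 + 2 (al - sa) sa) = E (al^2 - sa^2); the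
   [- sa ^+ 2] supplies the -1 next to each [Q i j]. *)
have QE : \sum_i \sum_j a i * a j * ((Q i j - 1) / t ^+ 2) =
    \sum_i \sum_j (a i / t) * (a j / t) * Q i j - sa ^+ 2.
  rewrite -saE -sumrB; apply: eq_bigr => i _; rewrite -sumrB.
  by apply: eq_bigr => j _; field.
rewrite QE big_split /= -!mulr_suml -mulr_sumr -/sa.
have -> : \sum_(i < n) \sum_(j < n) a i / t * (a j / t) * (E * Q i j) =
    E * \sum_i \sum_j (a i / t) * (a j / t) * Q i j.
  rewrite mulr_sumr; apply: eq_bigr => i _.
  by rewrite mulr_sumr; apply: eq_bigr => j _; rewrite mulrCA.
have -> : (\sum_(i < n) a i) / t = sa by rewrite mulr_suml.
ring.
Qed.

Lemma min_var_ge_derivative (al : R) (a b : 'I_n -> R) :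
  (forall i, t^-1 * (gamma (t *: e i + xt) - gamma xt)
     @[t --> (0 : R)^'] --> b i) ->
  ((2 * (al * gamma xt + \sum_i a i * b i)
    - expR (sqnorm u / sigma ^+ 2) *
      (al ^+ 2 + \sum_i \sum_j a i * a j * (G i j / sigma ^+ 2))
    - gamma x0 ^+ 2)%:E <= min_var S H sigma k c x0)%E.
Proof.
move=> db.
have mvq := min_var_ge_quotient al a.
(* The value +oo is trivial and -oo is excluded by the bound at step 1, so the limit is taken in a
   real inequality. *)
case: (min_var S H sigma k c x0) mvq => [v| |] mvq; last 2 first.
- by rewrite leey.
- by have := mvq 1 (oner_neq0 _); rewrite leeNy_eq.
rewrite lee_fin; apply: (@cvgr_to_le _ (0 : R)^' _ _ (fun t =>
  2 * (al * gamma xt +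
         \sum_i a i * (t^-1 * (gamma (t *: e i + xt) - gamma xt)))
    - expR (sqnorm u / sigma ^+ 2) *
      (al ^+ 2 + \sum_i \sum_j a i * a j *
         ((expR (t ^+ 2 * (G i j / sigma ^+ 2)) - 1) / t ^+ 2))
    - gamma x0 ^+ 2)).
  apply: cvgB; last exact: cvg_cst.
  apply: cvgB.
    apply: cvgMr; apply: cvgD; first exact: cvg_cst.
    apply: cvg_big => [|i _]; first exact: add_continuous.
    by apply: cvgMr; exact: db.
  apply: cvgMr; apply: cvgD; first exact: cvg_cst.
  apply: cvg_big => [|i _]; first exact: add_continuous.
  apply: cvg_big => [|j _]; first exact: add_continuous.
  by apply: cvgMr; exact: cvg_expR_quotient.
near=> t; rewrite -lee_fin; apply: mvq.
by near: t; exact: nbhs_dnbhs_neq.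
Unshelve. all: by end_near. Qed.

End difference_quotients.

(** * Specialisation to the coordinate directions in [K] with optimal coefficients *)

Theorem theorem8 (R : realType) (M N S : nat) (H : 'M[R]_(M, N)) (sigma : R)
  (k : 'I_N) (x0 : 'cV[R]_N) (K : {set 'I_N}) (xt : 'cV[R]_N)
  (c : 'cV[R]_N -> R) :
  (1 <= S <= N)%N ->
  (S < spark H)%N ->
  0 < sigma ->
  sparse_set S x0 ->
  (#|K| <= S)%N ->
  let HK := colsK H K in
  let P := HK *m mp_pinv HK in
  supp xt \subset K ->
  H *m xt = P *m H *m x0 ->
  (forall ki, ki \in K -> derivable c xt (delta_mx ki 0 : 'cV[R]_N)) ->
  let gamma := fun x : 'cV[R]_N => c x + x k 0 in
  let b : 'cV[R]_#|K| :=
    \col_i ((k == enum_val i)%:R + 'D_(delta_mx (enum_val i) 0) c xt) in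
  ((expR (- (sqnorm ((1%:M - P) *m H *m x0)) / sigma ^+ 2)
      * (sigma ^+ 2 * (b^T *m invmx (HK^T *m HK) *m b) 0 0 + gamma xt ^+ 2)
    - gamma x0 ^+ 2)%:E <= min_var S H sigma k c x0)%E.
Proof.
move=> _ SH sg0 sx0 KS HK P xtK Hxt dc; cbv beta zeta.
set b : 'cV[R]_#|K| := \col_i _.
pose gamma (x : 'cV[R]_N) := c x + x k 0.
have s0 : sigma != 0 by rewrite gt_eqF.
have /eqP rHK : cols_indep H K.
  by apply: spark_cols_indep; exact: leq_ltn_trans SH.
have uG := gram_unitmx rHK.
have [PHK _ PT _] : is_pinv HK (mp_pinv HK) := mp_pinvP rHK.
pose e (i : 'I_#|K|) : 'cV[R]_N := delta_mx (enum_val i) 0.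
have uE : H *m (xt - x0) = - ((1%:M - P) *m H *m x0).
  by rewrite mulmxBr Hxt mulmxBl mul1mx mulmxBl opprB.
have HKu : HK^T *m (H *m (xt - x0)) = 0.
  (* [P] is symmetric and fixes the columns of [HK], so HK^T (I - P) is the transpose of (I - P) HK
     = 0. *)
  rewrite uE mulmxN -mulmxA mulmxA -[HK^T *m _]trmxK trmx_mul trmxK.
  rewrite linearB /= trmx1 PT mulmxBl mul1mx /P PHK subrr trmx0.
  by rewrite mul0mx oppr0.
have ortho i : (H *m e i)^T *m (H *m (xt - x0)) = 0.
  by rewrite /e col_colsK tr_col -row_mul HKu row0.
have sxt : sparse_set S xt by exact: sparse_set_supp xtK.
have se i t : sparse_set S (t *: e i + xt).
  apply: (sparse_set_supp KS); apply/fintype.subsetP => j; rewrite inE !mxE.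
  case: (eqVneq j (enum_val i)) => [-> _|_] /=; first exact: enum_valP.
  by rewrite mulr0 add0r => xj; apply: (fintype.subsetP xtK); rewrite inE.
have GE i j : ((H *m e i)^T *m (H *m e j)) 0 0 = (HK^T *m HK) i j.
  rewrite /e !col_colsK -/HK !mxE.
  by apply: eq_bigr => l _; rewrite !mxE.
have db i : t^-1 * (gamma (t *: e i + xt) - gamma xt)
    @[t --> (0 : R)^'] --> b i 0.
  have dci := dc _ (enum_valP i); rewrite mxE addrC.
  apply: (@cvg_trans _ (t^-1 * (c (t *: e i + xt) - c xt) +
      (k == enum_val i)%:R @[t --> (0 : R)^'])).
    apply: near_eq_cvg; near=> t; rewrite /gamma !mxE eqxx andbT.
    have t0 : t != 0 by near: t; exact: nbhs_dnbhs_neq.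
    by field.
  by apply: cvgD; [exact: dci|exact: cvg_cst].
set D := sqnorm _.
have DE : sqnorm (H *m (xt - x0)) = D.
  by rewrite uE /D /sqnorm; apply: eq_bigr => i _; rewrite mxE sqrrN.
(* [E * gamma xt] and [a] maximise the concave quadratic 2 (al gamma + a.b) - E^-1 (al^2 + a^T G a /
   sigma^2), where G = HK^T HK; the stationarity condition in a is G a = E sigma^2 b. *)
pose E := expR (- D / sigma ^+ 2).
pose w := invmx (HK^T *m HK) *m b.
pose a i := E * sigma ^+ 2 * w i 0.
apply: le_trans (min_var_ge_derivative s0 sx0 sxt se ortho (E * gamma xt) a db).
rewrite lee_fin -/(gamma x0) -/(gamma xt) DE.
have EE : expR (D / sigma ^+ 2) * E = 1 by rewrite /E mulNr expRxMexpNx_1.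
set q := (_ *m _ *m b) 0 0.
have qE : q = \sum_i w i 0 * b i 0.
  rewrite /q -mulmxA mxE; apply: eq_bigr => i _; rewrite -/w mxE.
  exact: mulrC.
have -> : \sum_i a i * b i 0 = E * sigma ^+ 2 * q.
  by rewrite qE mulr_sumr; apply: eq_bigr => i _; rewrite /a -mulrA.
have -> : \sum_i \sum_j a i * a j *
    (((H *m e i)^T *m (H *m e j)) 0 0 / sigma ^+ 2) = E ^+ 2 * sigma ^+ 2 * q.
  rewrite qE mulr_sumr; apply: eq_bigr => i _.
  (* Since [w] solves G w = b, the quadratic form w^T G w equals [q]. *)
  have -> : b i 0 = \sum_j (HK^T *m HK) i j * w j 0.
    have -> : b = (HK^T *m HK) *m w by rewrite /w mulKVmx.
    by rewrite [LHS]mxE.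
  rewrite !mulr_sumr; apply: eq_bigr => j _; rewrite GE /a.
  by field.
rewrite -/E.
(* At the optimum the quadratic part is half the linear part, so one copy of E (gamma^2 + sigma^2 q)
   remains. *)
have -> : expR (D / sigma ^+ 2) *
    ((E * gamma xt) ^+ 2 + E ^+ 2 * sigma ^+ 2 * q) = E * (gamma xt ^+ 2 + sigma ^+ 2 * q).
  rewrite -[RHS]mul1r -EE; ring.
lra.
Unshelve. all: by end_near. Qed.
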